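(* Let $k$ be an algebraically closed field and let $P\subset\mathbb{R}^n$ be a lattice polytope with $\dim P=n$ and $\mathrm{gp}(S_P)=\mathbb{Z}^{n+1}$. Suppose a retraction $h:k[P]\to k[P]$ has a base $Q$ that intersects the interior of $P$. Then there exist a toric automorphism $\tau\in\mathbb{T}_k(P)$, a lattice fibration $(P,H,W)$ and a graded $k$-algebra embedding $\iota:k[H\cap P]\to k[P]$ such that $$h^{\tau}=\iota\circ\rho_{(P,H,W)}.$$ In particular, $h$ is tame.
   Context: A lattice polytope $P\subset\mathbb{R}^n$ is the convex hull of a finite set of points of $\mathbb{Z}^n$. Put $L_P=P\cap\mathbb{Z}^n$, and let $S_P\subset\mathbb{Z}^{n+1}$ be the sub-semigroup (with $0$) generated by $\{(x,1)\mid x\in L_P\}$; $\mathrm{gp}(S_P)$ is its group of differences. The algebra $k[P]:=k[S_P]$ is the semigroup algebra of $S_P$, graded by the last coordinate; $x\in L_P$ is identified with the degree $1$ element $(x,1)$. If $Q\subset P$ is a lattice subpolytope, $k[Q]$ is regarded as the subalgebra of $k[P]$ generated by $L_Q\subset L_P$. A retraction $h:k[P]\to k[P]$ is an idempotent homogeneous $k$-algebra endomorphism. More generally a homogeneous homomorphism $g:A\to B$ of graded $k$-algebras is called a retraction if there is a homogeneous homomorphism $f:B\to A$ with $g\circ f=1_B$. Base: with $A=\mathrm{Im}(h)$, a base of $h$ is a $(\dim A-1)$-dimensional cross section $Q=P\cap H'$ of $P$ by an affine subspace $H'$ such that $Q$ is a lattice polytope and $h|_{k[Q]}:k[Q]\to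 A$ is an isomorphism. $\Gamma_k(P)$ is the group of graded $k$-algebra automorphisms of $k[P]$, and $\mathbb{T}_k(P)\subset\Gamma_k(P)$ is the torus of toric automorphisms, i.e. those multiplying each monomial (element of $S_P$) by a scalar from $k^*$. For $\alpha\in\Gamma_k(P)$, $h^\alpha:=\alpha\circ h\circ\alpha^{-1}$. A lattice fibration $(P,H,W)$ consists of $P$, an affine subspace $H\subset\mathbb{R}^n$ and a vector subspace $W\subset\mathbb{R}^n$ with $\dim W+\dim H=n$ and $L_P\subset\bigcup_{x\in L_P\cap H}(x+W)$. Then $P\cap H$ is a lattice polytope with $\dim(P\cap H)=\dim H$, and $\rho_{(P,H,W)}:k[P]\to k[P\cap H]$ denotes the retraction sending each $x\in L_P$ to the unique point of $(x+W)\cap H$, which lies in $L_{P\cap H}$. For a face $F$ of $P$, $\pi_F:k[P]\to k[F]$ is the retraction which is the identity on $L_F$ and sends $L_P\setminus L_F$ to $0$. A retraction $f:k[P]\to k[P]$ is tame if there are lattice polytopes $P=P_m,P_{m-1},\dots,P_1,P_0=Q_0$, automorphisms $\alpha_i\in\Gamma_k(P_i)$, monomial structure preserving retractions $\pi_i:k[P_i]\to k[P_{i-1}]$ (i.e. sending monomials to monomials or to $0$, such as the maps $\pi_F$ and $\rho_{(P,H,W)}$), and a graded $k$-algebra embedding $\iota':k[Q_0]\to k[P]$ with $f=\iota'\circ\pi_1\circ\alpha_1\circ\cdots\circ\pi_m\circ\alpha_m$. *)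

(* Defs.v *)
From HB Require Import structures.
From mathcomp Require Import all_boot all_order all_algebra.
From mathcomp Require Import boolp classical_sets functions reals.
From mathcomp Require Import topology normedtype.
(* A plain Import of monalg fails: its notation levels clash with those of
   MathComp-Analysis. *)
From mathcomp Require Import -(notations) monalg.

Set Implicit Arguments.
Unset Strict Implicit.
Unset Printing Implicit Defensive.

Import Order.TTheory GRing.Theory Num.Theory.
Import numFieldNormedType.Exports.

Local Open Scope classical_set_scope.
Local Open Scope ring_scope.

Section Polytopes.
Context {R : realType} {n : nat}.
Implicit Types (X P : set 'rV[R]_n) (W : {vspace 'rV[R]_n}).

Definition to_real (x : 'rV[int]_n) : 'rV[R]_n := map_mx intr x.

Definition conv_hull (s : seq 'rV[R]_n) : set 'rV[R]_n :=
  [set x | exists w : 'I_(size s) -> R,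
     [/\ forall i, 0 <= w i, \sum_i w i = 1 & x = \sum_i w i *: s`_i]].

Definition lattice_polytope P : Prop :=
  exists s : seq 'rV[int]_n, P = conv_hull (map to_real s).

Definition lattice_points X : set 'rV[int]_n := [set x | X (to_real x)].

Record affine_subspace := AffineSubspace {
  aff_point : 'rV[R]_n;
  aff_dir : {vspace 'rV[R]_n} }.

Definition aff_set (H : affine_subspace) : set 'rV[R]_n :=
  [set x | x - aff_point H \in aff_dir H].

(* dim X is the dimension of the affine hull of X, and -1 if X is empty *)
Definition affdim_is X (d : int) : Prop :=
  (X = set0 /\ d = - 1) \/
  (X !=set0 /\ exists H : affine_subspace,
     [/\ X `<=` aff_set H,
         forall H' : affine_subspace,
           X `<=` aff_set H' -> aff_set H `<=` aff_set H'
       & (\dim (aff_dir H))%:Z = d]).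

End Polytopes.

Arguments affine_subspace : clear implicits.

(* Z^(n+1) is 'rV[int]_n * int, so that (x, 1) is literally a pair. *)
Definition semigroup_gen {n : nat} (L : set 'rV[int]_n) :
    set ('rV[int]_n * int) :=
  [set z | exists s : seq 'rV[int]_n,
     (forall x, x \in s -> L x) /\ z = \sum_(x <- s) (x, 1)].

Definition group_of_differences {n : nat} (S : set ('rV[int]_n * int)) :
    set ('rV[int]_n * int) :=
  [set z | exists a b, [/\ S a, S b & z = a - b]].

Record smonom (n : nat) (L : set 'rV[int]_n) := Smonom {
  smval : 'rV[int]_n * int;
  smvalP : `[< semigroup_gen L smval >] }.

Section Smonom.
Context {n : nat} (L : set 'rV[int]_n).

HB.instance Definition _ := [isSub for @smval n L].
HB.instance Definition _ := [Choice of smonom L by <:].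

Lemma semigroup_gen0 : semigroup_gen L 0.
Proof. by exists [::]; rewrite big_nil. Qed.

Lemma semigroup_genD a b :
  semigroup_gen L a -> semigroup_gen L b -> semigroup_gen L (a + b).
Proof.
move=> [s [sL ->]] [t [tL ->]]; exists (s ++ t); split; last by rewrite big_cat.
by move=> x; rewrite mem_cat => /orP[/sL|/tL].
Qed.

Lemma semigroup_gen_pt x : L x -> semigroup_gen L (x, 1).
Proof.
by move=> Lx; exists [:: x]; split=> [y|]; rewrite ?big_seq1 // inE => /eqP ->.
Qed.

Lemma semigroup_gen_ht a :
  semigroup_gen L a -> 0 <= a.2 /\ (a.2 = 0 -> a = 0).
Proof.
move=> [s [_ ->]]; elim: s => [|x s [IH1 _]]; first by rewrite big_nil.
rewrite big_cons; split; first by rewrite /= addr_ge0.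
by move=> /= /eqP; rewrite paddr_eq0 // => /andP[/eqP].
Qed.

Definition smone : smonom L := Smonom (asboolT semigroup_gen0).

Definition smmul (a b : smonom L) : smonom L :=
  Smonom (asboolT (semigroup_genD (asboolW (smvalP a)) (asboolW (smvalP b)))).

Lemma smmulA : associative smmul.
Proof. by move=> a b c; apply: val_inj; rewrite /= addrA. Qed.

Lemma smmul1m : left_id smone smmul.
Proof. by move=> a; apply: val_inj; rewrite /= add0r. Qed.

Lemma smmulm1 : right_id smone smmul.
Proof. by move=> a; apply: val_inj; rewrite /= addr0. Qed.

Lemma smmulC : commutative smmul.
Proof. by move=> a b; apply: val_inj; rewrite /= addrC. Qed.

Lemma smunit a b : smmul a b = smone -> a = smone /\ b = smone.
Proof.
have [ha0 ha] := semigroup_gen_ht (asboolW (smvalP a)).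
have [hb0 hb] := semigroup_gen_ht (asboolW (smvalP b)).
move=> /(congr1 (fun m => (smval m).2))/eqP /=.
rewrite paddr_eq0 // => /andP[/eqP/ha a0 /eqP/hb b0].
by split; apply: val_inj.
Qed.

HB.instance Definition _ :=
  Choice_isMonomialDef.Build (smonom L) smmulA smmul1m smmulm1 smunit.
HB.instance Definition _ := MonomialDef_isConomialDef.Build (smonom L) smmulC.

Definition smpoint x (Lx : L x) : smonom L :=
  Smonom (asboolT (semigroup_gen_pt Lx)).

End Smonom.

(* k[P], the algebra of the semigroup S_P generated by the (x, 1), x \in L_P *)
Notation polalg k P := (malg (smonom (lattice_points P)) k).

Section Algebras.
Context {k : fieldType} {R : realType}.

Definition mon {n} {P : set 'rV[R]_n} (m : smonom (lattice_points P)) :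
  polalg k P := mkmalgU m 1.

Definition xvar {n} {P : set 'rV[R]_n} {x} (Px : lattice_points P x) :
  polalg k P := mon (smpoint Px).

Definition homogeneous_of_degree {n} {P : set 'rV[R]_n} (d : nat)
    (a : polalg k P) : Prop :=
  forall m, mcoeff m a != 0 -> (smval m).2 = d%:Z.

Definition graded {n n'} {P : set 'rV[R]_n} {P' : set 'rV[R]_n'}
    (f : polalg k P -> polalg k P') : Prop :=
  forall d a, homogeneous_of_degree d a -> homogeneous_of_degree d (f a).

Definition idempotent_retraction {n} {P : set 'rV[R]_n}
    (h : {lrmorphism polalg k P -> polalg k P}) : Prop :=
  graded h /\ forall a, h (h a) = h a.

Definition split_retraction {n n'} {P : set 'rV[R]_n} {P' : set 'rV[R]_n'}
    (g : {lrmorphism polalg k P -> polalg k P'}) : Prop :=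
  graded g /\ exists f : {lrmorphism polalg k P' -> polalg k P},
    graded f /\ forall b, g (f b) = b.

Definition graded_embedding {n n'} {P : set 'rV[R]_n} {P' : set 'rV[R]_n'}
    (f : {lrmorphism polalg k P -> polalg k P'}) : Prop :=
  graded f /\ injective f.

(* the subalgebra k[Q] of k[P] *)
Definition sub_polalg {n} (P Q : set 'rV[R]_n) : set (polalg k P) :=
  smallest (fun B : set (polalg k P) => GRing.subalg_closed (mem B))
    [set a | exists x (Px : lattice_points P x),
               lattice_points Q x /\ a = xvar Px].

End Algebras.

Arguments sub_polalg k {R n} P Q.

(* A is meant to be a subring of T; its prime ideals are subsets of T. *)
Section KrullDimension.
Context {T : comNzRingType}.
Implicit Types A I : set T.

Definition prime_ideal_of A I : Prop :=
  [/\ I `<=` A, I 0 /\ ~ I 1,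
      forall x y, I x -> I y -> I (x + y),
      forall a x, A a -> I x -> I (a * x)
    & forall x y, A x -> A y -> I (x * y) -> I x \/ I y].

Definition prime_chain A (d : nat) (p : nat -> set T) : Prop :=
  (forall i, (i <= d)%N -> prime_ideal_of A (p i)) /\
  (forall i, (i < d)%N -> p i `<` p i.+1).

Definition krull_dim_is A (d : nat) : Prop :=
  (exists p, prime_chain A d p) /\
  (forall d' p, prime_chain A d' p -> (d' <= d)%N).

End KrullDimension.

Section Retractions.
Context {k : fieldType} {R : realType}.

(* The restriction of the homomorphism h to k[Q] is an isomorphism onto
   A = Im h as soon as it is a bijection. *)
Definition is_base {n} {P : set 'rV[R]_n}
    (h : {lrmorphism polalg k P -> polalg k P}) (Q : set 'rV[R]_n) : Prop :=
  [/\ exists H : affine_subspace R n, Q = P `&` aff_set H,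
      lattice_polytope Q,
      exists d : nat, krull_dim_is (range h) d /\ affdim_is Q (d%:Z - 1)
    & set_bij (sub_polalg k P Q) (range h) h].

Record graded_aut {n} (P : set 'rV[R]_n) := GradedAut {
  aut_fun :> {lrmorphism polalg k P -> polalg k P};
  aut_inv : {lrmorphism polalg k P -> polalg k P};
  aut_graded : graded aut_fun;
  aut_inv_graded : graded aut_inv;
  aut_funK : cancel aut_fun aut_inv;
  aut_invK : cancel aut_inv aut_fun }.

Definition toric {n} {P : set 'rV[R]_n} (alpha : graded_aut P) : Prop :=
  forall m : smonom (lattice_points P),
    exists2 c : k, c != 0 & alpha (mon m) = c *: mon m.

Definition conj_aut {n} {P : set 'rV[R]_n} (alpha : graded_aut P)
    (h : polalg k P -> polalg k P) : polalg k P -> polalg k P :=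
  alpha \o h \o aut_inv alpha.

Definition lattice_fibration {n} (P : set 'rV[R]_n) (H : affine_subspace R n)
    (W : {vspace 'rV[R]_n}) : Prop :=
  (\dim W + \dim (aff_dir H) = n)%N /\
  forall x, lattice_points P x ->
    exists y, lattice_points (P `&` aff_set H) y /\ to_real x - to_real y \in W.

(* These conditions determine rho, since k[P] is generated by the xvar Px. *)
Definition is_fibration_retraction {n} (P : set 'rV[R]_n)
    (H : affine_subspace R n) (W : {vspace 'rV[R]_n})
    (rho : {lrmorphism polalg k P -> polalg k (P `&` aff_set H)}) : Prop :=
  split_retraction rho /\
  forall x (Px : lattice_points P x),
    exists y (Py : lattice_points (P `&` aff_set H) y),
      [set z | z - to_real x \in W] `&` aff_set H = [set to_real y] /\
      rho (xvar Px) = xvar Py.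

Definition monomial_retraction {n n'} {P : set 'rV[R]_n} {P' : set 'rV[R]_n'}
    (g : {lrmorphism polalg k P -> polalg k P'}) : Prop :=
  split_retraction g /\
  forall m, g (mon m) = 0 \/ exists m', g (mon m) = mon m'.

(* tame_chain P Q0 g : g is a composite
   pi_1 \o alpha_1 \o ... \o pi_m \o alpha_m : k[P] -> k[Q0] *)
Inductive tame_chain : forall {n} (P : set 'rV[R]_n) {n0} (Q0 : set 'rV[R]_n0),
    (polalg k P -> polalg k Q0) -> Prop :=
| TameNil n (P : set 'rV[R]_n) of lattice_polytope P :
    tame_chain (id : polalg k P -> polalg k P)
| TameCons n (P : set 'rV[R]_n) n1 (P1 : set 'rV[R]_n1)
    n0 (Q0 : set 'rV[R]_n0) (alpha : graded_aut P)
    (pi : {lrmorphism polalg k P -> polalg k P1})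
    (g : polalg k P1 -> polalg k Q0)
    of lattice_polytope P & monomial_retraction pi & tame_chain g :
    tame_chain (g \o pi \o alpha).

Definition tame {n} {P : set 'rV[R]_n} (f : polalg k P -> polalg k P) : Prop :=
  exists n0 (Q0 : set 'rV[R]_n0) (g : polalg k P -> polalg k Q0)
         (iota : {lrmorphism polalg k Q0 -> polalg k P}),
    [/\ tame_chain g, graded_embedding iota & f =1 iota \o g].

End Retractions.

Arguments graded_aut k {R n} P.

(* Main.v *)
Require Import Defs.
From HB Require Import structures.
From mathcomp Require Import all_boot all_order all_algebra.
From mathcomp Require Import boolp classical_sets functions reals.
From mathcomp Require Import topology normedtype.
From mathcomp Require Import -(notations) monalg.
From mathcomp Require Import ring.
Import Order.TTheory GRing.Theory Num.Theory.
Import numFieldNormedType.Exports.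
Local Open Scope classical_set_scope.
Local Open Scope ring_scope.
Set Implicit Arguments.
Unset Strict Implicit.

(** The retraction theorem rests on the fact that every factor of a monomial in
    the algebra of a subsemigroup of Z^(n+1) is a scalar times a monomial.

    Let j : k[Q] -> k[P] be the inclusion followed by h. The base condition
    makes j an isomorphism onto the image of h, so j^-1 o h is a retraction of
    k[P] onto k[Q]. Since Q meets the interior of P, every monomial m of k[P]
    divides a monomial q of k[Q] (lattice_point_divides, monomial_divides): a
    point z of Q in the interior of P can be moved slightly away from a given x
    in P without leaving P, which writes a positive multiple of z as x plus a
    nonnegative combination of vertices of P, and a real relation among lattice
    points can be replaced by one with natural coefficients (natural_relation).
    Applying j^-1 o h to m r = q exhibits the image of m as a factor of the
    monomial q, hence as a scalar c(m) times a monomial Y(m)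
    (lattice_monomial_divisor, monomials_up_to_scalars).

    Both c and Y are then multiplicative. The function c defines the toric
    automorphism tau. The map Y extends to an idempotent endomorphism of
    gp(S_P) = Z^(n+1) that preserves the last coordinate, hence to an
    idempotent integer matrix M acting on Z^n; its image is the direction of H,
    its kernel is W, and P meets H exactly in Q (lattice_map_fibration). With
    rho the fibration retraction, which is Y on monomials, h = j o rho o tau:
    conjugating by tau gives h^tau = (tau o j) o rho, and the factorization
    itself shows that h is tame. *)

(** * From real to natural relations among integer vectors *)

Lemma clear_denominators m n (K : 'M[rat]_(m, n)) :
  exists2 d : int, 0 < d &
    exists K' : 'M[int]_(m, n), map_mx intr K' = d%:~R *: K.
Proof.
pose D i j := denq (K i j).
exists (\prod_i \prod_j D i j).
  by apply: prodr_gt0 => i _; apply: prodr_gt0 => j _; apply: denq_gt0.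
exists (\matrix_(i, j) (numq (K i j) *
  ((\prod_(j' | j' != j) D i j') * \prod_(i' | i' != i) \prod_j' D i' j'))).
apply/matrixP => i j; rewrite !mxE [in RHS](bigD1 i) //= [in RHS](bigD1 j) //=.
by rewrite !rmorphM /= numqE [RHS]mulrC -!mulrA.
Qed.

(** The solutions that vanish wherever u does form the kernel of a rational
    matrix, which has an integral spanning set. Writing a large multiple of the
    real solution in this spanning set and rounding the coefficients down
    changes each entry by a bounded amount, so positive entries stay
    positive. *)
Lemma natural_relation (R : archiRealFieldType) (I J : finType)
    (A : I -> J -> int) (u : I -> R) :
  (forall i, 0 <= u i) -> (forall j, \sum_i u i * (A i j)%:~R = 0) ->
  exists c : I -> nat, (forall i, 0 < u i -> (0 < c i)%N) /\
    forall j, \sum_i A i j *+ c i = 0.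
Proof.
move=> u_ge0 uA.
(* The extra columns indexed by I force an entry to vanish where u does. *)
pose B i (j : J + I) : int :=
  match j with inl j => A i j | inr i' => ((i == i') && (u i == 0))%:R end.
have uB j : \sum_i u i * (B i j)%:~R = 0.
  case: j => [j|i'] /=; first exact: uA.
  by apply: big1 => i _; case: eqP => // _; case: eqP => [->|] /=; rewrite ?mul0r ?mulr0.
pose BQ : 'M[rat]_(#|I|, #|{: J + I}|) :=
  \matrix_(i, j) (B (enum_val i) (enum_val j))%:~R.
pose uM : 'rV[R]_#|I| := \row_i u (enum_val i).
have : (uM <= kermx (map_mx ratr BQ))%MS.
  apply/sub_kermxP/rowP => j; rewrite !mxE -[RHS](uB (enum_val j)).
  rewrite [RHS](reindex (enum_val : 'I_#|I| -> I)) /=; last exact/onW_bij/enum_val_bij.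
  by apply: eq_bigr => i _; rewrite !mxE ratr_int.
rewrite -map_kermx => /submxP [v uv].
have [d d_gt0 [K' dK]] := clear_denominators (kermx BQ).
pose C i := \sum_j `|ratr (kermx BQ j (enum_rank i)) : R|.
(* Rounding changes entry i by at most C i, so N has to exceed C i / u i
   whenever u i is positive. *)
pose N := (\sum_i Num.bound (C i / u i))%N.
pose w : 'rV[int]_#|I| := \row_j Num.floor (N%:R * v 0 j).
pose y i : int := (w *m K') 0 (enum_rank i).
have yB j : \sum_i y i * B i j = 0.
  have /matrixP/(_ 0 (enum_rank j)) : map_mx intr (w *m K') *m BQ = 0.
    rewrite map_mxM dK -!scalemxAr -!scalemxAl -mulmxA.
    by rewrite (sub_kermxP (submx_refl _)) mulmx0 scaler0.
  rewrite !mxE => Bj; apply: (@intr_inj rat); rewrite -[RHS]Bj rmorph_sum /=.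
  rewrite [LHS](reindex (enum_val : 'I_#|I| -> I)) /=; last exact/onW_bij/enum_val_bij.
  by apply: eq_bigr => i _; rewrite ![in RHS]mxE enum_rankK rmorphM /y enum_valK mxE.
have y_gt0 i : 0 < u i -> 0 < y i.
  move=> ui; rewrite -(ltr0z R).
  have yE : (y i)%:~R = d%:~R * \sum_j (w 0 j)%:~R * ratr (kermx BQ j (enum_rank i)) :> R.
    rewrite /y !mxE rmorph_sum mulr_sumr /=; apply: eq_bigr => j _.
    move/matrixP/(_ j (enum_rank i)): dK; rewrite !mxE => /(congr1 (@ratr R)).
    by rewrite ratr_int rmorphM /= ratr_int rmorphM /= => ->; rewrite mulrCA.
  rewrite yE mulr_gt0 ?ltr0z //.
  have NuE : N%:R * u i = \sum_j N%:R * v 0 j * ratr (kermx BQ j (enum_rank i)).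
    move/rowP/(_ (enum_rank i)): uv; rewrite !mxE enum_rankK => ->.
    by rewrite mulr_sumr; apply: eq_bigr => j _; rewrite mxE mulrA.
  have CN : C i < N%:R * u i.
    rewrite -ltr_pdivrMr // (lt_le_trans (archi_boundP _)) //.
      by rewrite divr_ge0 ?sumr_ge0 // ltW.
    by rewrite ler_nat /N (bigD1 i) //= leq_addr.
  have : N%:R * u i - \sum_j (w 0 j)%:~R * ratr (kermx BQ j (enum_rank i)) <= C i.
    rewrite NuE -sumrB; apply: ler_sum => j _; rewrite -mulrBl.
    rewrite (le_trans (ler_norm _)) // normrM ler_piMl // mxE.
    have /andP[le lt] := floor_itv (N%:R * v 0 j).
    by rewrite ger0_norm ?subr_ge0 // lerBlDl (le_trans (ltW lt)) // intrD.
  by rewrite lerBlDl => /(lt_le_trans CN); rewrite ltrDr.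
have y_ge0 i : 0 <= y i.
  have := u_ge0 i; rewrite le_eqVlt => /orP[ui|/y_gt0/ltW//].
  have := yB (inr i); rewrite (bigD1 i) //= eqxx eq_sym ui mulr1 big1 ?addr0 => [->//|k ki].
  by rewrite (negbTE ki) mulr0.
exists (fun i => `|y i|%N); split=> [i /y_gt0|j].
  by rewrite -ltz_nat gez0_abs.
rewrite -[RHS](yB (inl j)); apply: eq_bigr => i _ /=.
by rewrite -mulr_natr natz gez0_abs // mulrC.
Qed.

(** * Factors of monomials *)

Section UniqueProducts.
(* M is ordered through its image in G, pos being the cone of positive
   elements of G. *)
Context (M : conomType) (k : idomainType) (G : zmodType) (v : M -> G).
Context (pos : G -> Prop).
Hypotheses (vM : forall a b, v (mul a b) = v a + v b)
  (posD : forall x y, pos x -> pos y -> pos (x + y))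
  (pos0 : ~ pos 0)
  (pos_total : forall a b, a <> b -> pos (v a - v b) \/ pos (v b - v a)).

Definition is_top (s : seq M) a :=
  a \in s /\ forall b, b \in s -> b <> a -> pos (v a - v b).

Lemma top_exists (s : seq M) : s != [::] -> exists a, is_top s a.
Proof.
elim: s => // a s IH _; have [->|/IH [b [bs bmax]]] := eqVneq s [::].
  by exists a; split=> [|c]; rewrite inE // => /eqP.
have [ab|/eqP ab] := eqVneq a b.
  exists b; split=> [|c]; rewrite inE ?bs ?orbT // => /orP[/eqP-> //|]; last exact: bmax.
case: (pos_total ab) => p.
  exists a; split=> [|c]; rewrite inE ?eqxx // => /orP[/eqP-> //|cs _].
  have [->//|/eqP cb] := eqVneq c b.
  by rewrite -(subrKA (v b)); apply: posD => //; apply: bmax.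
exists b; split=> [|c]; rewrite inE ?bs ?orbT // => /orP[/eqP-> //|]; exact: bmax.
Qed.

(** The product of the greatest monomials of f and g arises from no other pair
    of monomials, so nothing can cancel it. *)
Lemma mcoeffM_top (f g : malg M k) a b :
  is_top (finmap.enum_fset (msupp f)) a -> is_top (finmap.enum_fset (msupp g)) b ->
  mcoeff (mul a b) (f * g) = mcoeff a f * mcoeff b g.
Proof.
move=> [af amax] [bg bmax]; rewrite mcoeffMl.
rewrite (bigD1_seq a) ?finmap.fset_uniq //= (bigD1_seq b) ?finmap.fset_uniq //= eqxx.
rewrite mulr1n -addrA [X in _ + X]addrC.
have neq a' b' : a' \in finmap.enum_fset (msupp f) -> b' \in finmap.enum_fset (msupp g) ->
    (a', b') != (a, b) -> (mul a' b' == mul a b) = false.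
  move=> a'f b'g ab; apply/eqP => /(congr1 v); rewrite !vM => e.
  have : v a - v a' + (v b - v b') = 0 by rewrite addrACA -opprD e subrr.
  have [aE|/eqP an] := eqVneq a' a; have [bE|/eqP bn] := eqVneq b' b.
  - by rewrite aE bE eqxx in ab.
  - by rewrite aE subrr add0r => z; have := bmax _ b'g bn; rewrite z => /pos0.
  - by rewrite bE subrr addr0 => z; have := amax _ a'f an; rewrite z => /pos0.
  - by move=> z; have := posD (amax _ a'f an) (bmax _ b'g bn); rewrite z => /pos0.
rewrite [X in _ + (X + _)]big_seq_cond [X in _ + (_ + X)]big_seq_cond !big1 ?addr0 //.
- by move=> b' /andP[b'g b'b]; rewrite neq // xpair_eqE (negbTE b'b) andbF.
- move=> a' /andP[a'f a'a]; rewrite big_seq_cond big1 // => b' /andP[b'g _].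
  by rewrite neq // xpair_eqE (negbTE a'a).
Qed.

End UniqueProducts.

(** Both the product of the greatest monomials of f and g and the product of
    their least monomials must be q. The greatest ones are at least the least
    ones, so they coincide, and f has a single monomial. *)
Lemma monomial_divisor (M : conomType) (k : idomainType) (G : zmodType)
    (v : M -> G) (pos : G -> Prop) :
  (forall a b, v (mul a b) = v a + v b) -> injective v ->
  (forall x y, pos x -> pos y -> pos (x + y)) -> ~ pos 0 ->
  (forall x, x <> 0 -> pos x \/ pos (- x)) ->
  forall (f g : malg M k) q, f * g = mkmalgU q 1 ->
    exists a m, a != 0 /\ f = mkmalgU m a.
Proof.
move=> vM vI posD pos0 pos_total f g q fgE.
have total (a b : M) : a <> b -> pos (v a - v b) \/ pos (v b - v a).
  by move=> ab; rewrite -[v b - v a]opprB; apply: pos_total => /subr0_eq/vI.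
(* The least monomials are the greatest ones for the opposite order. *)
pose neg x := pos (- x).
have negD x y : neg x -> neg y -> neg (x + y) by rewrite /neg opprD; apply: posD.
have neg0 : ~ neg 0 by rewrite /neg oppr0.
have ntotal (a b : M) : a <> b -> neg (v a - v b) \/ neg (v b - v a).
  by rewrite /neg !opprB => /total[]; [right|left].
have nz (x y : malg M k) : x * y = mkmalgU q 1 -> finmap.enum_fset (msupp x) != [::].
  move=> xy; apply/eqP => x0; suff x_0 : x = 0.
    by move/eqP: xy; rewrite x_0 mul0r eq_sym monalgU_eq0 oner_eq0.
  by rewrite [x]monalgE x0 big_nil.
have gfE : g * f = mkmalgU q 1 by rewrite mulrC.
have topP pos' (t : forall (a b : M), a <> b -> pos' (v a - v b) \/ pos' (v b - v a))
    (D : forall x y, pos' x -> pos' y -> pos' (x + y)) (p0 : ~ pos' 0) :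
    exists2 a, is_top v pos' (finmap.enum_fset (msupp f)) a &
    exists2 b, is_top v pos' (finmap.enum_fset (msupp g)) b & mul a b = q.
  have [a fa] := top_exists D t (nz _ _ fgE).
  have [b gb] := top_exists D t (nz _ _ gfE).
  exists a => //; exists b => //.
  have := mcoeffM_top vM D p0 fa gb; rewrite fgE mcoeffU.
  case: eqP => // _ /eqP; rewrite eq_sym mulf_eq0.
  by rewrite !mcoeff_eq0 fa.1 gb.1.
have [a [af amax] [b [bg bmax] abq]] := topP _ total posD pos0.
have [a' [a'f amin] [b' [b'g bmin] ab'q]] := topP _ ntotal negD neg0.
have aa' : a' = a.
  have : v a - v a' + (v b - v b') = 0 by rewrite addrACA -opprD -!vM abq ab'q subrr.
  have [//|/eqP an] := eqVneq a' a; have pa := amax _ a'f an.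
  have [->|/eqP bn] := eqVneq b' b; last first.
    by move=> z; have := posD _ _ pa (bmax _ b'g bn); rewrite z => /pos0.
  by rewrite subrr addr0 => z; rewrite z in pa.
exists (mcoeff a f), a; split; first by rewrite mcoeff_neq0.
rewrite [LHS]monalgE (bigD1_seq a) ?finmap.fset_uniq //= big_seq_cond big1 ?addr0 //.
move=> c /andP[cf /eqP ca]; have := posD _ _ (amax _ cf ca).
have := amin _ cf; rewrite aa' => /(_ ca); rewrite /neg opprB => p /(_ _ p).
by rewrite addrA subrK subrr => /pos0.
Qed.

Section MonomialCoordinates.
Context {n : nat}.
Implicit Types z : 'rV[int]_n * int.

(** The degree comes first and indices range over nat, so that one index runs
    through all n + 1 coordinates and the indices are well-ordered. *)
Definition coordinate (j : nat) z : int :=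
  if j is i.+1 then oapp (fun i : 'I_n => z.1 0 i) 0 (insub i) else z.2.

Fact coordinate_is_zmod_morphism j : zmod_morphism (coordinate j).
Proof.
move=> y z; case: j => //= j.
by case: insubP => [i _ _|_] /=; rewrite ?mxE ?subrr.
Qed.

HB.instance Definition _ j := GRing.isZmodMorphism.Build
  ('rV[int]_n * int)%type int (coordinate j) (coordinate_is_zmod_morphism j).

Lemma coordinate_eq0 z : (forall j, (j < n.+1)%N -> coordinate j z = 0) -> z = 0.
Proof.
case: z => x d z0; rewrite (z0 0%N isT : d = 0); congr pair; apply/rowP => i.
by have := z0 i.+1 (ltn_ord i); rewrite /= valK /= mxE.
Qed.

(** The positive cone of the lexicographic order on Z^(n+1). *)
Definition lex_positive z :=
  exists j, 0 < coordinate j z /\ forall i, (i < j)%N -> coordinate i z = 0.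

Lemma lex_positiveD y z : lex_positive y -> lex_positive z -> lex_positive (y + z).
Proof.
move=> [i [yi iP]] [j [zj jP]]; exists (minn i j); split=> [|l]; last first.
  by rewrite leq_min raddfD /= => /andP[/iP-> /jP->].
rewrite raddfD /=; have [ij|ji|ij] := ltngtP i j.
- by rewrite (jP i) ?addr0.
- by rewrite (iP j) ?add0r.
- by rewrite addr_gt0 // ij.
Qed.

Lemma lex_positive0 : ~ lex_positive 0.
Proof. by move=> [j [+ _]]; rewrite raddf0 ltxx. Qed.

Lemma lex_positive_total z : z <> 0 -> lex_positive z \/ lex_positive (- z).
Proof.
move=> z0; have ex : exists j, coordinate j z != 0.
  apply: contrapT => /forallNP all0; apply: z0; apply: coordinate_eq0 => j _.
  by apply/eqP; apply: contrapT => /negP; apply: all0.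
case: (ex_minnP ex) => j zj jmin.
have jP i : (i < j)%N -> coordinate i z = 0.
  by apply: contraTeq => /jmin; rewrite -leqNgt.
have [zl|zg|/eqP] := ltgtP (coordinate j z) 0; last by rewrite (negbTE zj).
- right; exists j; rewrite raddfN oppr_gt0; split=> // i /jP.
  by rewrite raddfN /= => ->; rewrite oppr0.
- by left; exists j.
Qed.

End MonomialCoordinates.

(** * Polytopal algebras and their homomorphisms *)

(** The universal property of a monoid algebra; it serves to build the inclusion
    of k[Q], the toric automorphisms and the fibration retraction. *)
Lemma malg_lift (M : conomType) (k : fieldType) (A : comAlgType k) (f : M -> A) :
  f one = 1 -> {morph f : a b / mul a b >-> a * b} ->
  exists g : {lrmorphism malg M k -> A}, forall m, g (mkmalgU m 1) = f m.
Proof.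
move=> f1 fM.
pose fmorph := isMultiplicative.Build M A f (conj fM f1).
pose F : MMorphism.type M A := HB.pack f fmorph.
pose g0 := mmap (GRing.in_alg A) F.
have g0Z : scalable g0 by move=> c a; rewrite /g0 mmapZ mulr_algl.
pose gmorph := GRing.isScalable.Build k (malg M k) A *:%R g0 g0Z.
pose g : {lrmorphism malg M k -> A} := HB.pack g0 (GRing.RMorphism.on g0) gmorph.
by exists g => m; rewrite /= /g0 mmapU /= scale1r mul1r.
Qed.

Lemma malgUE (M : conomType) (k : fieldType) (m : M) (c : k) :
  mkmalgU m c = c *: mkmalgU m 1.
Proof. by apply/malgP => m'; rewrite mcoeffZ !mcoeffU mulrnAr mulr1. Qed.

Lemma malg_ext (M : conomType) (k : fieldType) (V : lmodType k)
    (f g : {linear malg M k -> V}) :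
  (forall m, f (mkmalgU m 1) = g (mkmalgU m 1)) -> f =1 g.
Proof.
move=> fg a; rewrite (monalgE a) !linear_sum; apply: eq_bigr => m _.
by rewrite malgUE !linearZ fg.
Qed.

Lemma malgU_inj (M : conomType) (k : fieldType) (m m' : M) (a b : k) :
  a != 0 -> mkmalgU m a = mkmalgU m' b -> a = b /\ m = m'.
Proof.
move=> a0 /(congr1 (mcoeff m)); rewrite mcoeffUU mcoeffU.
by case: eqP => [->|_] //= e; rewrite e eqxx in a0.
Qed.

Lemma smmulE n (L : set 'rV[int]_n) (a b : smonom L) :
  smval (mul a b) = smval a + smval b.
Proof. by []. Qed.

Lemma smonom_ind n (L : set 'rV[int]_n) (T : smonom L -> Prop) :
  T one -> (forall x (Lx : L x) m, T m -> T (mul (smpoint Lx) m)) ->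
  forall m, T m.
Proof.
move=> T1 TM [z zP]; have [s [sL zE]] := asboolW zP.
elim: s z zP sL zE => [|x s IH] z zP sL zE.
  rewrite big_nil in zE; suff -> : Smonom zP = one by [].
  exact: val_inj.
have Ls y : y \in s -> L y by move=> ys; apply: sL; rewrite inE ys orbT.
have Lx : L x by apply: sL; rewrite inE eqxx.
have sP : `[< semigroup_gen L (\sum_(x <- s) (x, 1)) >] by apply/asboolP; exists s.
have -> : Smonom zP = mul (smpoint Lx) (Smonom sP).
  by apply: val_inj; rewrite /= zE big_cons.
by apply: TM; apply: IH.
Qed.

Lemma semigroup_genS n (L L' : set 'rV[int]_n) :
  L `<=` L' -> semigroup_gen L `<=` semigroup_gen L'.
Proof. by move=> LL' z [s [sL ->]]; exists s; split=> // x /sL/LL'. Qed.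

Section PolytopalAlgebras.
Context {k : fieldType} {R : realType} {n : nat}.
Implicit Types P Q : set 'rV[R]_n.

Definition smwiden P Q (QP : Q `<=` P) (m : smonom (lattice_points Q)) :
    smonom (lattice_points P) :=
  Smonom (asboolT (semigroup_genS (fun x => QP (to_real x)) (asboolW (smvalP m)))).

Lemma smwiden_inj P Q (QP : Q `<=` P) : injective (smwiden QP).
Proof. by move=> a b /(congr1 (@smval _ _)) /= ab; apply: val_inj. Qed.

(** The lexicographic order on Z^(n+1) makes S_P a totally ordered monoid. *)
Lemma lattice_monomial_divisor P (f g : polalg k P) q :
  f * g = mon q -> exists a m, a != 0 /\ f = a *: mon m.
Proof.
move=> /(monomial_divisor (@smmulE n _) val_inj (@lex_positiveD n)
   (@lex_positive0 n) (@lex_positive_total n)) [a [m [a0 fE]]].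
by exists a, m; rewrite -malgUE.
Qed.

Lemma smval_nat P (m : smonom (lattice_points P)) : exists d : nat, (smval m).2 = d%:Z.
Proof.
have [] := semigroup_gen_ht (asboolW (smvalP m)).
by case: ((smval m).2) => // d _ _; exists d.
Qed.

Lemma mon_homogeneous P (m : smonom (lattice_points P)) (d : nat) :
  (smval m).2 = d%:Z -> homogeneous_of_degree d (mon m : polalg k P).
Proof. by move=> md m'; rewrite /mon mcoeffU; have [<-|] := eqVneq m m'; rewrite ?eqxx. Qed.

Lemma graded_of_mon P Q (f : {lrmorphism polalg k P -> polalg k Q}) :
  (forall m (d : nat), (smval m).2 = d%:Z -> homogeneous_of_degree d (f (mon m))) ->
  graded f.
Proof.
move=> fmon d a ad m' m'P.
have [m ma mP] : exists2 m, m \in finmap.enum_fset (msupp a) & mcoeff m' (f (mon m)) != 0.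
  apply: contrapT => /forall2NP none; case/eqP: m'P.
  rewrite [a]monalgE linear_sum raddf_sum big_seq big1 //= => m ma.
  rewrite malgUE linearZ /= mcoeffZ; case: (none m) => // /negP.
  by rewrite negbK => /eqP ->; rewrite mulr0.
by apply: fmon mP; apply: ad; rewrite mcoeff_neq0.
Qed.

Lemma graded_comp P1 P2 P3 (f : polalg k P1 -> polalg k P2) (g : polalg k P2 -> polalg k P3) :
  graded f -> graded g -> graded (g \o f).
Proof. by move=> fG gG d a /fG/gG. Qed.

Lemma mon1 P : mon one = 1 :> polalg k P.
Proof. by []. Qed.

Lemma monM P : {morph @mon k R n P : a b / mul a b >-> a * b}.
Proof. by move=> a b; rewrite malgM_def fgmulUU mulr1. Qed.

Lemma rmorph_monM P Q (f : {lrmorphism polalg k P -> polalg k Q}) a b :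
  f (mon (mul a b)) = f (mon a) * f (mon b).
Proof. exact: etrans (congr1 f (monM a b)) (rmorphM f _ _). Qed.

(** The subalgebra of k[P] generated by L_Q is a copy of k[Q], which allows the
    base condition to be read as a statement on a homomorphism from k[Q]. *)
Lemma inclusion_exists P Q (QP : Q `<=` P) :
  exists inc : {lrmorphism polalg k Q -> polalg k P},
    [/\ forall m, inc (mon m) = mon (smwiden QP m), graded inc, injective inc
      & sub_polalg k P Q = range inc].
Proof.
have [||inc incE] := @malg_lift _ k (polalg k P) (fun m => mon (smwiden QP m)).
- by rewrite -mon1; congr mon; exact: val_inj.
- by move=> a b; rewrite -monM; congr mon; exact: val_inj.
exists inc; split=> //.
- apply: graded_of_mon => m d md; rewrite incE; exact: mon_homogeneous.
- have coefE a m : mcoeff m a = mcoeff (smwiden QP m) (inc a).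
    rewrite {1 2}[a]monalgE linear_sum !raddf_sum; apply: eq_bigr => m' _ /=.
    rewrite malgUE [inc _]linearZ /= incE !mcoeffZ !mcoeffU.
    rewrite (inj_eq (@smwiden_inj _ _ QP)); exact: erefl.
  by move=> a b ab; apply/malgP => m; rewrite !coefE ab.
apply/seteqP; split.
  move=> a /(_ (range inc)); apply; split; last first.
    move=> _ [x [Px [Qx ->]]]; exists (xvar Qx) => //.
    by rewrite incE; congr mon; apply: val_inj.
  split=> [|c _ _ /set_mem[a1 _ <-] /set_mem[b1 _ <-]
           |_ _ /set_mem[a1 _ <-] /set_mem[b1 _ <-]]; apply: mem_set.
  - by exists 1; rewrite ?rmorph1.
  - by exists (c *: a1 + b1); rewrite ?linearP.
  - by exists (a1 * b1); rewrite ?rmorphM.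
move=> _ [b _ <-] B [[B1 BZ BM] Bgen].
have BD x y : B x -> B y -> B (x + y).
  by move=> /mem_set Bx /mem_set By; apply: set_mem; rewrite -[x]scale1r; apply: BZ.
have B0 : B 0 by apply: set_mem; rewrite -[0](subrr 1) addrC -scaleN1r; apply: BZ.
have Bmon m : B (inc (mon m)).
  elim/smonom_ind: m => [|x Qx m Bm]; first by rewrite mon1 rmorph1; apply: set_mem.
  rewrite rmorph_monM; apply: set_mem; apply: BM; apply: mem_set; last exact: Bm.
  apply: Bgen; exists x, (QP _ Qx); split=> //.
  by rewrite incE; congr mon; apply: val_inj.
rewrite [b]monalgE linear_sum; apply: big_ind => // m _.
rewrite malgUE linearZ /= -[_ *: _]addr0.
by apply: set_mem; apply: BZ; apply: mem_set; [apply: Bmon|].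
Qed.

End PolytopalAlgebras.

(** * Consequences of meeting the interior *)

Section InteriorPoints.
Context {R : realType} {n : nat}.
Implicit Types P Q : set 'rV[R]_n.

Lemma conv_hull_nth (s : seq 'rV[R]_n) (i : 'I_(size s)) : conv_hull s s`_i.
Proof.
exists (fun j => (i == j)%:R); split=> [j||]; first exact: ler0n.
- by rewrite (bigD1 i) //= eqxx big1 ?addr0 // => j ji; rewrite eq_sym (negbTE ji).
- rewrite (bigD1 i) //= eqxx scale1r big1 ?addr0 // => j ji.
  by rewrite eq_sym (negbTE ji) scale0r.
Qed.

(** An interior point can be pushed a little further away from any point x. *)
Lemma interior_extend P z x : interior P z ->
  exists2 t : R, 0 < t & P (z + t *: (z - x)).
Proof.
move=> /nbhs_ballP [e e0 zP].
have N0 : 0 < 1 + `|z - x| by rewrite ltr_pwDl.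
exists (e / 2 / (1 + `|z - x|)); first by rewrite !divr_gt0.
apply: zP; rewrite mx_norm_ball /ball_ /= opprD addNKr normrN normrZ.
rewrite gtr0_norm ?divr_gt0 // (@le_lt_trans _ _ (e / 2)) //; last first.
  by rewrite ltr_pdivrMr // ltr_pMr // ltr1n.
by rewrite mulrAC ler_pdivrMr // ler_pM2l ?divr_gt0 // lerDr.
Qed.

(** The real counterpart of the coordinates of (x, 1): the leading 1 records
    that the weights of a convex combination add up to 1. *)
Definition affine_coordinate (j : nat) (p : 'rV[R]_n) : R :=
  if j is i.+1 then oapp (fun i : 'I_n => p 0 i) 0 (insub i) else 1.

Lemma affine_coordinate_to_real (x : 'rV[int]_n) j :
  (coordinate j (x, 1 : int))%:~R = affine_coordinate j (to_real x).
Proof. by case: j => //= j; case: insubP => //= i _ _; rewrite mxE. Qed.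

Lemma affine_coordinate_conv (I : finType) (w : I -> R) (p : I -> 'rV[R]_n) j :
  \sum_i w i = 1 ->
  affine_coordinate j (\sum_i w i *: p i) = \sum_i w i * affine_coordinate j (p i).
Proof.
move=> w1; case: j => [|j] /=; first by rewrite -mulr_suml w1 mulr1.
case: insubP => [i _ _|_] /=; last by rewrite big1 // => i _; rewrite mulr0.
by rewrite summxE; apply: eq_bigr => j' _; rewrite mxE.
Qed.

Lemma sum_unit (V : zmodType) (F : unit -> V) : \sum_i F i = F tt.
Proof. by rewrite (bigD1 tt) //= big1 ?addr0 // => -[]. Qed.

Lemma semigroup_genMn (L : set 'rV[int]_n) z c :
  semigroup_gen L z -> semigroup_gen L (z *+ c).
Proof.
move=> Lz; elim: c => [|c IH]; first exact: semigroup_gen0.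
by rewrite mulrS; apply: semigroup_genD.
Qed.

Lemma semigroup_gen_sum (L : set 'rV[int]_n) (I : finType) (x : I -> 'rV[int]_n)
    (c : I -> nat) :
  (forall i, L (x i)) -> semigroup_gen L (\sum_i (x i, 1) *+ c i).
Proof.
move=> Lx; apply: big_ind => [||i _]; [exact: semigroup_gen0|exact: semigroup_genD|].
by apply: semigroup_genMn; apply: semigroup_gen_pt.
Qed.

(** Let z be a point of Q in the interior of P. Then z + e (z - x) lies in P for
    some e > 0. Expanding z over the vertices t of Q and z + e (z - x) over the
    vertices s of P gives a relation between the (t, 1), the (s, 1) and (x, 1)
    in which x has coefficient e > 0; a natural relation with the same positive
    coefficients has x on the opposite side from the t. *)
Lemma lattice_point_divides P Q x :
  lattice_polytope P -> lattice_polytope Q -> Q `&` interior P !=set0 ->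
  lattice_points P x ->
  exists q r, [/\ semigroup_gen (lattice_points Q) q,
    semigroup_gen (lattice_points P) r & q = (x, 1) + r].
Proof.
move=> [s PE] [t QE] [z [Qz /(@interior_extend _ _ (to_real x)) [e e0 zP]]] Px.
move: zP; rewrite {1}PE => -[w [w0 w1 wE]].
move: Qz; rewrite {1}QE => -[w' [w'0 w'1 w'E]].
pose S : seq 'rV[R]_n := [seq to_real y | y <- s].
pose T : seq 'rV[R]_n := [seq to_real y | y <- t].
have Sx i : S`_i = to_real s`_i.
  have [si|si] := ltnP i (size s); first by rewrite (nth_map 0).
  by rewrite !nth_default ?size_map //; apply/rowP => j; rewrite !mxE.
have Tx i : T`_i = to_real t`_i.
  have [si|si] := ltnP i (size t); first by rewrite (nth_map 0).
  by rewrite !nth_default ?size_map //; apply/rowP => j; rewrite !mxE.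
pose I : finType := ('I_(size T) + ('I_(size S) + unit))%type.
pose a (i : I) : 'rV[int]_n * int := match i with
  | inl i => (t`_i, 1) | inr (inl i) => - (s`_i, 1) | inr (inr _) => - (x, 1) end.
(* (1 + e) z - (z + e (z - x)) - e x = 0. *)
pose u (i : I) : R := match i with
  | inl i => (1 + e) * w' i | inr (inl i) => w i | inr (inr _) => e end.
have [||c [c_gt0 cE]] := @natural_relation R I 'I_n.+1 (fun i j => coordinate j (a i)) u.
- by move=> [i|[i|i]] /=; rewrite ?mulr_ge0 ?w0 ?w'0 ?addr_ge0 // ltW.
- move=> [j jn]; rewrite !big_sumType /= sum_unit.
  under eq_bigr do rewrite affine_coordinate_to_real -Tx -mulrA.
  under [X in _ + (X + _)]eq_bigr do
    rewrite raddfN rmorphN /= affine_coordinate_to_real -Sx mulrN.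
  rewrite raddfN rmorphN /= affine_coordinate_to_real mulrN sumrN -mulr_sumr.
  rewrite -!affine_coordinate_conv // -wE -w'E.
  case: j jn => [|j] _ /=; first by ring.
  by case: insubP => [i _ _|_] /=; rewrite ?mxE; ring.
have c0 := c_gt0 (inr (inr tt)) e0.
exists (\sum_(i < size T) (t`_i, 1) *+ c (inl i)).
exists (\sum_(i < size S) (s`_i, 1) *+ c (inr (inl i)) + (x, 1) *+ (c (inr (inr tt))).-1).
split.
- apply: semigroup_gen_sum => i; rewrite /lattice_points /= -Tx QE; exact: conv_hull_nth.
- apply: semigroup_genD; first apply: semigroup_gen_sum => i.
    by rewrite /lattice_points /= -Sx PE; exact: conv_hull_nth.
  by apply: semigroup_genMn; apply: semigroup_gen_pt.
apply/eqP; rewrite -subr_eq0; apply/eqP; apply: coordinate_eq0 => j jn.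
rewrite -[RHS](cE (Ordinal jn)) /= !big_sumType /= sum_unit.
have -> : coordinate j (- (x, 1)) *+ c (inr (inr tt)) =
    - coordinate j (x, 1) - coordinate j (x, 1) *+ (c (inr (inr tt))).-1.
  by rewrite raddfN mulNrn -{1}(prednK c0) mulrS opprD.
rewrite !(raddfB, raddfD) /= raddfMn !raddf_sum /=.
under eq_bigr do rewrite raddfMn.
under [X in _ = _ + (X + _)]eq_bigr do rewrite raddfN mulNrn -raddfMn.
rewrite sumrN; congr (_ + _).
by rewrite addrCA.
Qed.

End InteriorPoints.

(** * Lattice projections and fibrations *)

(** Additivity makes f a - f b depend only on the difference a - b. *)
Lemma extend_to_differences n (L : set 'rV[int]_n) (V : zmodType)
    (f : smonom L -> V) :
  group_of_differences (semigroup_gen L) = setT ->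
  (forall a b, f (mul a b) = f a + f b) ->
  exists2 F : {additive 'rV[int]_n * int -> V}, forall m, F (smval m) = f m &
    forall z, exists a b, [/\ z = smval a - smval b & F z = f a - f b].
Proof.
move=> gpL fM.
have diff z : exists ab : smonom L * smonom L, z = smval ab.1 - smval ab.2.
  have : setT z by []; rewrite -gpL => -[a [b [La Lb ->]]].
  by exists (Smonom (asboolT La), Smonom (asboolT Lb)).
have [d dE] := choice diff.
pose F z := f (d z).1 - f (d z).2.
have FE z a b : z = smval a - smval b -> F z = f a - f b.
  move=> zE; apply/eqP; rewrite subr_eq addrAC eq_sym subr_eq -!fM; apply/eqP.
  congr f; apply: val_inj => /=; apply/eqP.
  by rewrite eq_sym -subr_eq addrAC eq_sym -subr_eq -dE -zE.
have F_add : zmod_morphism F.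
  move=> y z; rewrite (FE _ (mul (d y).1 (d z).2) (mul (d y).2 (d z).1)).
    by rewrite !fM opprD opprB addrACA.
  by rewrite /= opprD addrACA -[smval (d z).2 - _]opprB -!dE.
pose FM := GRing.isZmodMorphism.Build _ _ F F_add.
pose G : {additive 'rV[int]_n * int -> V} := HB.pack F FM.
exists G => [m|z]; last by exists (d z).1, (d z).2.
have m1 : smval m = smval m - smval (one : smonom L) by rewrite /= subr0.
rewrite /G /= (FE _ _ _ m1).
by apply/eqP; rewrite subr_eq -fM mulm1.
Qed.

Lemma additive_mulmx n m (f : {additive 'rV[int]_n -> 'rV[int]_m}) :
  exists M : 'M[int]_(n, m), forall x, f x = x *m M.
Proof.
exists (\matrix_i f (delta_mx 0 i)) => x.
rewrite {1}[x]row_sum_delta mulmx_sum_row raddf_sum; apply: eq_bigr => i _.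
by rewrite rowK -[x 0 i]intz !scaler_int raddfMz.
Qed.

Section Fibrations.
Context {R : realType} {n : nat}.
Implicit Types P Q : set 'rV[R]_n.

(** The image of M is spanned by vectors parallel to the affine space H0 that
    cuts out Q, and it contains all differences of points of Q. The translate
    of the image of M through a lattice point of Q therefore also cuts out Q
    from P, while having the dimension complementary to that of ker M. *)
Lemma lattice_projection_fibration P Q (H0 : affine_subspace R n) (M : 'M[int]_n) :
  Q = P `&` aff_set H0 -> lattice_polytope Q -> Q !=set0 ->
  M *m M = M ->
  (forall q q', lattice_points Q q -> lattice_points Q q' -> (q - q') *m M = q - q') ->
  (forall x, to_real (x *m M) \in aff_dir H0) ->
  exists (H : affine_subspace R n) (W : {vspace 'rV[R]_n}),
    [/\ Q = P `&` aff_set H, (\dim W + \dim (aff_dir H) = n)%N,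
      forall x, (x *m M = 0) -> to_real x \in W
    & forall v v', aff_set H v -> aff_set H v' -> v - v' \in W -> v = v'].
Proof.
move=> QE [t tE] Q0 MM MQ MH.
pose MR : 'M[R]_n := map_mx intr M.
have to_realM x : to_real (x *m M) = to_real x *m MR :> 'rV[R]_n by rewrite /to_real map_mxM.
have to_realB x y : to_real (x - y) = to_real x - to_real y :> 'rV[R]_n.
  by rewrite /to_real raddfB.
have MRM : MR *m MR = MR by rewrite -map_mxM MM.
pose p : 'End('rV[R]_n) := linfun (mulmxr MR).
have pE v : p v = v *m MR by rewrite lfunE.
pose T : seq 'rV[R]_n := [seq to_real x | x <- t].
have QtE i : (i < size T)%N -> T`_i = to_real t`_i.
  by rewrite size_map => it; rewrite (nth_map 0).
have Qt i : (i < size T)%N -> lattice_points Q t`_i.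
  by move=> it; rewrite /lattice_points /= -QtE // tE; exact: (conv_hull_nth (Ordinal it)).
have [q Lq] : exists q, lattice_points Q q.
  have [t0|t_gt0] := posnP (size T); last by exists t`_0; exact: Qt.
  case: Q0 => z; rewrite tE => -[w [_ + _]].
  rewrite big1 => [/eqP|i _]; first by rewrite eq_sym oner_eq0.
  by suff: (i < 0)%N by []; rewrite -[X in (_ < X)%N]t0 ltn_ord.
have pH v : v *m MR \in aff_dir H0.
  rewrite mulmx_sum_row memv_suml // => i _; rewrite memvZ //.
  suff -> : row i MR = to_real (delta_mx 0 i *m M) by [].
  by rewrite -rowE; apply/rowP => j; rewrite !mxE.
exists (AffineSubspace (to_real q) (limg p)), (lker p); split.
- rewrite QE; apply/seteqP; split=> v [Pv] /= Hv; split=> //; rewrite /aff_set /=.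
    have : Q v by rewrite QE.
    rewrite tE => -[w [_ w1 ->]].
    rewrite -[to_real q]scale1r -w1 scaler_suml -sumrB memv_suml // => i _.
    rewrite -scalerBr memvZ // QtE // -to_realB.
    rewrite -(MQ _ _ (Qt _ (ltn_ord i)) Lq) to_realM -pE; exact: memv_img (memvf _).
  move/memv_imgP: Hv => [u _]; rewrite pE /= => uE.
  have : Q (to_real q) by []; rewrite QE => -[_]; rewrite /aff_set /= => qH.
  by rewrite -(subrK (to_real q) v) -addrA memvD //; have := pH u; rewrite -uE.
- rewrite /= -[X in (X + _)%N]/(\dim (lker p)) -(capfv (lker p)).
  by rewrite limg_ker_dim dimvf /dim /= mul1n.
- by move=> x xM; rewrite memv_ker pE -to_realM xM; apply/eqP/rowP => j; rewrite !mxE.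
move=> v v'; rewrite /aff_set /= => /memv_imgP[u _ uE] /memv_imgP[u' _ u'E].
have vE : v - v' = p u - p u' by rewrite -uE -u'E opprB addrA subrK.
rewrite memv_ker vE raddfB /= !pE -!mulmxA MRM => uu'.
by apply/eqP; rewrite -subr_eq0 vE !pE.
Qed.

End Fibrations.

(** * Retractions with a base that meets the interior *)

Section Retraction.
Context {k : fieldType} {R : realType} {n : nat}.
Implicit Types P Q : set 'rV[R]_n.

Lemma monomial_divides P Q (QP : Q `<=` P) :
  lattice_polytope P -> lattice_polytope Q -> Q `&` interior P !=set0 ->
  forall m : smonom (lattice_points P), exists q r, mul m r = smwiden QP q.
Proof.
move=> Ppoly Qpoly QintP; elim/smonom_ind => [|x Px m [q [r mr]]].
  by exists one, one; apply: val_inj; rewrite /= addr0.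
have [q' [r' [Sq' Sr' qrE]]] := lattice_point_divides Ppoly Qpoly QintP Px.
exists (mul (Smonom (asboolT Sq')) q), (mul (Smonom (asboolT Sr')) r).
apply: val_inj => /=; move/(congr1 (@smval _ _)): mr => /= mr.
by rewrite addrACA mr qrE.
Qed.

Lemma polalg_scaleM P (a b : k) (f g : polalg k P) :
  (a *: f) * (b *: g) = (a * b) *: (f * g).
Proof. by rewrite -scalerAl -scalerAr scalerA. Qed.

(** If m r = q with q in S_Q, then j^-1 (h m) is a factor of the monomial q of
    k[Q]. *)
Lemma monomials_up_to_scalars P Q (QP : Q `<=` P)
    (h : {lrmorphism polalg k P -> polalg k P})
    (j : {lrmorphism polalg k Q -> polalg k P}) :
  (forall m, exists q r, mul m r = smwiden QP q) ->
  (forall q, h (mon (smwiden QP q)) = j (mon q)) ->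
  (forall a, exists b, h a = j b) -> injective j ->
  forall m, exists cy : k * smonom (lattice_points Q),
    cy.1 != 0 /\ h (mon m) = cy.1 *: j (mon cy.2).
Proof.
move=> div hj hrange jI m; have [q [r mr]] := div m.
have [f fE] := hrange (mon m); have [g gE] := hrange (mon r).
have /lattice_monomial_divisor [c [y [c0 fc]]] : f * g = mon q.
  have fgE : j (f * g) = j f * j g := rmorphM j f g.
  have mrE : j f * j g = h (mon m) * h (mon r) := congr2 *%R (esym fE) (esym gE).
  apply: jI; exact (etrans fgE (etrans mrE (etrans (esym (rmorph_monM h m r))
    (etrans (congr1 (fun z => h (mon z)) mr) (hj q))))).
exists (c, y); split=> //; exact (etrans fE (etrans (congr1 j fc) (linearZ _ _))).
Qed.

Lemma homogeneous_degree_unique P (d d' : nat) (f : polalg k P) :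
  f != 0 -> homogeneous_of_degree d f -> homogeneous_of_degree d' f -> d = d'.
Proof.
move=> /eqP f0 fd fd'; apply: contrapT => dd'; apply: f0; apply/malgP => m.
rewrite mcoeff0; apply/eqP; apply: contrapT => /negP fm; apply: dd'.
by apply/eqP; rewrite -eqz_nat -(fd _ fm) -(fd' _ fm).
Qed.

(** The degree of a monomial can be read off from its image, which is nonzero. *)
Lemma degree_up_to_scalar P Q (h : {lrmorphism polalg k P -> polalg k P})
    (j : {lrmorphism polalg k Q -> polalg k P}) (b : k) m y :
  graded h -> graded j -> injective j -> b != 0 -> h (mon m) = b *: j (mon y) ->
  (smval y).2 = (smval m).2.
Proof.
move=> hG jG jI b0 hE; have [d md] := smval_nat m; have [d' yd] := smval_nat y.
have jy0 : j (mon y) != 0.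
  apply/eqP => jy; have := jI _ _ (etrans jy (esym (raddf0 j))).
  by move/eqP; rewrite monalgU_eq0 oner_eq0.
rewrite md yd; congr Posz; apply: (homogeneous_degree_unique jy0).
  exact/jG/mon_homogeneous.
move=> m' jm'; apply: (hG d (mon m) (mon_homogeneous md)).
by rewrite hE mcoeffZ mulf_neq0.
Qed.

(** A multiplicative function with nonzero values rescales the monomials, and its
    pointwise inverse undoes this. *)
Lemma toric_aut_exists P (c : smonom (lattice_points P) -> k) :
  (forall m, c m != 0) -> c one = 1 -> {morph c : a b / mul a b >-> a * b} ->
  exists2 tau : graded_aut k P, toric tau & forall m, tau (mon m) = c m *: mon m.
Proof.
move=> c0 c1 cM.
have scale_exists (b : smonom (lattice_points P) -> k) :
    b one = 1 -> {morph b : x y / mul x y >-> x * y} ->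
    exists2 t : {lrmorphism polalg k P -> polalg k P},
      graded t & forall m, t (mon m) = b m *: mon m.
  move=> b1 bM; have [||t tE] := @malg_lift _ k (polalg k P) (fun m => b m *: mon m).
  - by rewrite b1 scale1r mon1.
  - by move=> x y; rewrite bM monM -scalerAl -scalerAr scalerA.
  exists t => //; apply: graded_of_mon => m d md m'; rewrite tE mcoeffZ mulf_eq0 negb_or.
  by case/andP=> _; apply: mon_homogeneous.
have [t tG tE] := scale_exists c c1 cM.
have [||t' t'G t'E] := scale_exists (fun m => (c m)^-1); first by rewrite c1 invr1.
  by move=> x y; rewrite cM invfM.
have tK : cancel t t'.
  apply: (malg_ext (f := t' \o t) (g := idfun)) => m /=.
  by rewrite [t _]tE linearZ /= [t' _]t'E scalerA divff // scale1r.
have t'K : cancel t' t.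
  apply: (malg_ext (f := t \o t') (g := idfun)) => m /=.
  by rewrite [t' _]t'E linearZ /= [t _]tE scalerA mulVf // scale1r.
exists (GradedAut tG t'G tK t'K); last exact: tE.
move=> m; exists (c m); [exact: c0 | exact: tE].
Qed.

End Retraction.

Lemma semigroup_gen_degree1 n (L : set 'rV[int]_n) z :
  semigroup_gen L z -> z.2 = 1 -> L z.1.
Proof.
move=> [s [sL ->]]; rewrite !raddf_sum /=.
case: s sL => [|x [|y s]] sL; first by rewrite big_nil.
  by rewrite !big_seq1 => _; apply: sL; rewrite inE.
rewrite !big_cons => /eqP; rewrite -[X in _ == X]addr0 (inj_eq (addrI _)) gt_eqF //.
by rewrite ltr_pwDl // sumr_ge0.
Qed.

Lemma semigroup_gen_affine (R : realType) n (X : set 'rV[R]_n) (H : affine_subspace R n) z :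
  X `<=` aff_set H -> semigroup_gen (lattice_points X) z ->
  to_real z.1 - z.2%:~R *: aff_point H \in aff_dir H.
Proof.
move=> XH [s [sX ->]]; elim: s sX => [|x s IH] sX.
  by rewrite big_nil /= /to_real raddf0 scale0r subrr mem0v.
rewrite big_cons /= /to_real raddfD /= rmorphD /= scalerDl scale1r opprD addrACA.
apply: memvD; first by apply: (XH (to_real x)); apply: sX; rewrite inE eqxx.
by apply: IH => y ys; apply: sX; rewrite inE ys orbT.
Qed.

(** The extension F of Y to Z^(n+1) preserves degrees and is idempotent because Y
    fixes S_Q. On Z^n x 0 it is therefore given by an idempotent matrix, to
    which lattice_projection_fibration applies. *)
Lemma lattice_map_fibration (R : realType) n (P Q : set 'rV[R]_n) (QP : Q `<=` P)
    (H0 : affine_subspace R n)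
    (Y : smonom (lattice_points P) -> smonom (lattice_points Q)) :
  group_of_differences (semigroup_gen (lattice_points P)) = setT ->
  Q = P `&` aff_set H0 -> lattice_polytope Q -> Q !=set0 ->
  {morph Y : a b / mul a b >-> mul a b} -> cancel (smwiden QP) Y ->
  (forall m, (smval (Y m)).2 = (smval m).2) ->
  exists (H : affine_subspace R n) (W : {vspace 'rV[R]_n}),
    [/\ Q = P `&` aff_set H, (\dim W + \dim (aff_dir H) = n)%N,
      forall x (Px : lattice_points P x), exists y (Qy : lattice_points Q y),
        Y (smpoint Px) = smpoint Qy /\ to_real x - to_real y \in W
    & forall v v', aff_set H v -> aff_set H v' -> v - v' \in W -> v = v'].
Proof.
move=> gpP QE Qpoly Q0 YM YQ Ydeg.
have [F FE Fdiff] := extend_to_differences (f := fun m => smval (Y m)) gpP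
  (fun a b => congr1 (@smval _ _) (YM a b)).
have FQ (y : smonom (lattice_points Q)) : F (smval y) = smval y.
  exact: etrans (FE (smwiden QP y)) (congr1 (@smval _ _) (YQ y)).
have Fdeg z : (F z).2 = z.2.
  by have [a [b [-> ->]]] := Fdiff z; rewrite /= !Ydeg.
(* Every value of F is a difference of elements of S_Q, where F is the identity. *)
have FF z : F (F z) = F z.
  by have [a [b [_ ->]]] := Fdiff z; rewrite raddfB /= !FQ.
pose p (x : 'rV[int]_n) := (F (x, 0)).1.
have p_add : zmod_morphism p.
  by move=> x y; rewrite /p -[(x - y, 0)]/((x, 0) - (y, 0)) raddfB.
pose pM := GRing.isZmodMorphism.Build _ _ p p_add.
have [M ME] := additive_mulmx (HB.pack p pM : {additive 'rV[int]_n -> 'rV[int]_n}).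
have {}ME x : F (x, 0) = (x *m M, 0).
  by rewrite -ME /= /p; case: (F (x, 0)) (Fdeg (x, 0)) => ? ? /= ->.
have MB x y : (x - y) *m M = (F (x, 1)).1 - (F (y, 1)).1.
  have := ME (x - y); rewrite -[(x - y, 0)]/((x, 1) - (y, 1)) raddfB.
  by move=> /(congr1 fst) /= ->.
have FP x (Px : lattice_points P x) : F (x, 1) = smval (Y (smpoint Px)).
  by rewrite -FE.
have FpQ y (Qy : lattice_points Q y) : F (y, 1) = (y, 1) by apply: (FQ (smpoint Qy)).
have [|||H [W [QH dimHW MW HW]]] := lattice_projection_fibration QE Qpoly Q0 (M := M).
- apply/row_matrixP => i; rewrite !rowE mulmxA.
  by have := FF (delta_mx 0 i, 0); rewrite !ME => -[].
- by move=> q q' Lq Lq'; rewrite MB !FpQ.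
- move=> x; have [a [b [_ Fab]]] := Fdiff (x, 0); have := Fab; rewrite ME => -[xM ab].
  have QH0 : Q `<=` aff_set H0 by rewrite QE => v [].
  have := memvB (semigroup_gen_affine QH0 (asboolW (smvalP (Y a))))
    (semigroup_gen_affine QH0 (asboolW (smvalP (Y b)))).
  move/eqP: ab; rewrite eq_sym subr_eq0 => /eqP ->.
  by rewrite opprB addrA subrK xM /to_real raddfB.
exists H, W; split=> // x Px.
have Qy : lattice_points Q (smval (Y (smpoint Px))).1.
  by apply: semigroup_gen_degree1; [exact: (asboolW (smvalP _)) | rewrite Ydeg].
have YE : Y (smpoint Px) = smpoint Qy.
  by apply: val_inj => /=; rewrite [LHS]surjective_pairing Ydeg.
exists _, Qy; split=> //; rewrite -raddfB; apply: MW.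
by rewrite MB (FpQ _ Qy) (FP _ Px) subrr.
Qed.

Theorem theorem7p2 (R : realType) (k : closedFieldType) (n : nat)
    (P : set 'rV[R]_n)
    (P_polytope : lattice_polytope P)
    (dimP : affdim_is P n%:Z)
    (gpP : group_of_differences (semigroup_gen (lattice_points P)) = setT)
    (h : {lrmorphism polalg k P -> polalg k P})
    (h_retraction : idempotent_retraction h)
    (Q : set 'rV[R]_n)
    (Q_base : is_base h Q)
    (Q_interior : Q `&` interior P !=set0) :
  (exists (tau : graded_aut k P) (H : affine_subspace R n)
          (W : {vspace 'rV[R]_n})
          (rho : {lrmorphism polalg k P -> polalg k (P `&` aff_set H)})
          (iota : {lrmorphism polalg k (P `&` aff_set H) -> polalg k P}),
     [/\ toric tau,
         lattice_fibration P H W,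
         is_fibration_retraction W rho,
         graded_embedding iota
       & conj_aut tau h =1 iota \o rho])
  /\ tame h.
Proof.
case: h_retraction => hG _; case: Q_base => [[H0 QE] Qpoly _ hQ].
have QP : Q `<=` P by rewrite QE => x [].
have [inc [incE incG incI incR]] := inclusion_exists (k := k) QP.
rewrite incR in hQ; case: hQ => _ hI hsurj.
pose j : {lrmorphism polalg k Q -> polalg k P} := h \o inc.
have jI : injective j.
  by move=> a b /= /hI ab; apply: incI; apply: ab; apply: mem_set; eexists.
have jG : graded j by apply: graded_comp.
have hj q : h (mon (smwiden QP q)) = j (mon q) by rewrite /j /= incE.
have hrange a : exists b, h a = j b.
  by have [_ [b _ <-] hb] := hsurj (h a) (ex_intro2 _ _ a I erefl); exists b.
have div := monomial_divides QP P_polytope Qpoly Q_interior.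
have [cy cyP] := choice (monomials_up_to_scalars div hj hrange jI).
pose c m := (cy m).1; pose Y m := (cy m).2.
have c0 m : c m != 0 by have [] := cyP m.
have hE m : h (mon m) = c m *: j (mon (Y m)) by have [] := cyP m.
have scalar_uniq m b y : h (mon m) = b *: j (mon y) -> c m = b /\ Y m = y.
  by rewrite hE -!linearZ => /jI; rewrite /mon -!malgUE; apply: malgU_inj.
have [cM YM] : {morph c : a b / mul a b >-> a * b} /\
    {morph Y : a b / mul a b >-> mul a b}.
  suff cYM a b : c (mul a b) = c a * c b /\ Y (mul a b) = mul (Y a) (Y b).
    by split=> a b; have [] := cYM a b.
  apply: scalar_uniq; exact (etrans (rmorph_monM h a b) (etrans (congr2 *%R (hE a) (hE b))
    (etrans (polalg_scaleM _ _ _ _) (congr1 (GRing.scale _) (esym (rmorph_monM j _ _)))))).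
have cYQ q : c (smwiden QP q) = 1 /\ Y (smwiden QP q) = q.
  by apply: scalar_uniq; rewrite scale1r.
have one_widen : one = smwiden QP one by apply: val_inj.
have [c1 Y1] : c one = 1 /\ Y one = one by rewrite one_widen.
have Ydeg m : (smval (Y m)).2 = (smval m).2.
  by apply: (degree_up_to_scalar hG jG jI (c0 m)).
have Q0 : Q !=set0 by case: Q_interior => z [Qz _]; exists z.
have YQ : cancel (smwiden QP) Y by move=> q; have [] := cYQ q.
have [H [W [QH dimHW YW HW]]] := lattice_map_fibration gpP QE Qpoly Q0 YM YQ Ydeg.
have [rho rhoE] : exists rho : {lrmorphism polalg k P -> polalg k Q},
    forall m, rho (mon m) = mon (Y m).
  by apply: malg_lift => [|a b]; rewrite ?Y1 // YM monM.
have rhoG : graded rho.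
  by apply: graded_of_mon => m d md; rewrite rhoE; apply: mon_homogeneous; rewrite Ydeg.
have rhoK b : rho (inc b) = b.
  apply: (malg_ext (f := rho \o inc) (g := idfun)) => m /=.
  exact (etrans (congr1 rho (incE m)) (etrans (rhoE _) (congr1 mon (YQ m)))).
have rho_split : split_retraction rho by split=> //; exists inc.
have [tau tauT tauE] := toric_aut_exists c0 c1 cM.
(* The factorization behind both claims, checked on monomials. *)
have hrho a : h a = j (rho (tau a)).
  apply: (malg_ext (f := h) (g := j \o rho \o tau)) => m /=.
  apply: etrans (hE m) _; apply: esym.
  apply: etrans (congr1 (j \o rho) (tauE m)) _ => /=.
  apply: etrans (congr1 j (linearZ _ _)) _; apply: etrans (linearZ _ _) _.
  exact (congr1 (fun z => c m *: j z) (rhoE m)).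
pose iota : {lrmorphism polalg k Q -> polalg k P} := tau \o j.
have iotaG : graded_embedding iota.
  split; first by apply: graded_comp => //; exact: aut_graded.
  by move=> a b /= /(can_inj (aut_funK tau))/jI.
have hconj : conj_aut tau h =1 iota \o rho.
  move=> a; exact (congr1 tau (etrans (hrho _) (congr1 (j \o rho) (aut_invK tau a)))).
clear QE; subst Q.
split.
  exists tau, H, W, rho, iota; split=> //.
    split=> // x Px; have [y [Qy [_ xyW]]] := YW x Px.
    by exists y.
  split=> // x Px; have [y [Qy [Yx xyW]]] := YW x Px; exists y, Qy; split.
    apply/seteqP; split=> z /=.
      move=> [zxW Hz]; apply: HW => //; first exact: Qy.2.
      by rewrite -(subrKA (to_real x)) memvD.
    move=> ->; split; last exact: Qy.2.
    by rewrite -opprB memvN.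
  exact (etrans (rhoE _) (congr1 mon Yx)).
exists n, (P `&` aff_set H), (id \o rho \o tau), j; split.
- apply: TameCons => //; last exact: TameNil.
  by split=> // m; right; exists (Y m).
- by split.
- exact: hrho.
Qed.
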